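(* Let $(N_n)_{n\ge 1}$ be a cumulative INAR($\infty$) process with immigration rate $\nu>0$ and reproduction coefficients $\alpha=(\alpha_k)_{k\ge1}$, $\alpha_k\ge 0$, such that $\|\alpha\|_1<1$ and $\|\alpha\|_2^2<\frac12$, and let $(X_n)_{n\ge1}$ be its increments. Let $T$ be a positive integer and let $s=(\nu,\alpha_1,\dots,\alpha_{T-1})$. For any $f=(\mu,\beta_1,\dots,\beta_{T-1})\in\mathfrak{l}^2=\mathbb{R}^T$ define $$\gamma_T(f):=-\frac{2}{T}\sum_{n=1}^T\Phi_f(n)X_n+\frac1T\sum_{n=1}^T\Phi_f^2(n),\qquad \Phi_f(n):=\mu+\sum_{k=1}^{n-1}\beta_kX_{n-k}.$$ Then $\gamma_T$ is a contrast, i.e. the function $f\mapsto\mathbb{E}[\gamma_T(f)]$ on $\mathfrak{l}^2$ reaches its minimum when $f=s$.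
   Context: Notation: $\|\alpha\|_1=\sum_{k\ge1}|\alpha_k|$ and $\|\alpha\|_2^2=\sum_{k\ge1}\alpha_k^2$. Empty sums are $0$. Cumulative INAR($\infty$) process (started at time 1, with empty history): given $\nu>0$ and a nonnegative sequence $\alpha=(\alpha_k)_{k\ge1}\in\ell^1$, $(X_n)_{n\ge1}$ is a sequence of nonnegative-integer-valued random variables with natural filtration $\mathcal{F}_n=\sigma(X_1,\dots,X_n)$ (and $\mathcal{F}_0$ trivial) such that, for every $n\ge1$, conditionally on $\mathcal{F}_{n-1}$, $X_n$ has the Poisson distribution with parameter $$\lambda_n=\nu+\sum_{k=1}^{n-1}\alpha_{n-k}X_k .$$ The cumulative process is $N_n=\sum_{k=1}^nX_k$. Parameter space: $\mathfrak{l}^2=\{f=(\mu,\beta)=(\mu,\beta_1,\dots,\beta_{T-1})\}$ is the $T$-dimensional Euclidean space with inner product $\langle f,g\rangle=\mu\xi+\sum_{k=1}^{T-1}\beta_k\gamma_k$ for $f=(\mu,\beta)$, $g=(\xi,\gamma)$. The true parameter is $s=(\nu,\alpha_1,\dots,\alpha_{T-1})$, and $\Phi_s(n)=\lambda_n$ for $1\le n\le T$. *)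

(* Defs.v *)
From mathcomp Require Import all_boot all_order all_algebra.
From mathcomp Require Import all_classical all_reals all_analysis.
From mathcomp Require Import measurable_realfun.
Set Implicit Arguments.
Unset Strict Implicit.
Unset Printing Implicit Defensive.
Import Order.TTheory GRing.Theory Num.Theory.
Import numFieldNormedType.Exports.
Local Open Scope classical_set_scope.
Local Open Scope ring_scope.

(* Sequences indexed by k >= 1 are functions on nat whose value at 0 is
   never used.  Norms are extended reals, so that [_ < 1] includes
   convergence of the series. *)
Definition l1norm (R : realType) (a : nat -> R) : \bar R :=
  (\sum_(1 <= k <oo) `|a k|%:E)%E.

Definition l2norm_sq (R : realType) (a : nat -> R) : \bar R :=
  (\sum_(1 <= k <oo) (a k ^+ 2)%:E)%E.

(* F_n = sigma(X_1, ..., X_n); F_0 is generated by the empty family. *)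
Definition nat_filtration d (Omega : measurableType d) (R : realType)
    (P : probability Omega R) (X : nat -> {RV P >-> nat}) (n : nat) :
    set (set Omega) :=
  g_sigma_preimage (fun i : 'I_n => X i.+1 : Omega -> nat).

(* [kappa] is a version of the conditional distribution of Y given the
   sub-sigma-algebra F: kappa(., B) is F-measurable, and its integral over
   A in F is P(A, Y in B). *)
Definition cond_distribution d d' (Omega : measurableType d)
    (E : measurableType d') (R : realType) (P : probability Omega R)
    (F : set (set Omega)) (Y : {RV P >-> E})
    (kappa : Omega -> set E -> \bar R) : Prop :=
  forall B : set E, measurable B ->
    (forall U : set (\bar R), measurable U ->
       F ((fun w => kappa w B) @^-1` U)) /\
    (forall A : set Omega, F A ->
       P (A `&` Y @^-1` B) = \int[P]_(w in A) kappa w B)%E.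

Definition inar_intensity d (Omega : measurableType d) (R : realType)
    (P : probability Omega R) (nu : R) (alpha : nat -> R)
    (X : nat -> {RV P >-> nat}) (n : nat) (w : Omega) : R :=
  nu + \sum_(1 <= k < n) alpha (n - k)%N * (X k w)%:R.

(* The second argument of [poisson_prob] is a dummy. *)
Definition is_INAR d (Omega : measurableType d) (R : realType)
    (P : probability Omega R) (nu : R) (alpha : nat -> R)
    (X : nat -> {RV P >-> nat}) : Prop :=
  forall n : nat, (1 <= n)%N ->
    cond_distribution (nat_filtration X n.-1) (X n)
      (fun w => poisson_prob (inar_intensity nu alpha X n w) 0%N).

Definition is_cumulative_INAR d (Omega : measurableType d) (R : realType)
    (P : probability Omega R) (nu : R) (alpha : nat -> R)
    (N : nat -> Omega -> nat) (X : nat -> {RV P >-> nat}) : Prop :=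
  is_INAR nu alpha X /\
  forall (n : nat) (w : Omega), (1 <= n)%N ->
    N n w = (\sum_(1 <= k < n.+1) X k w)%N.

(* Parameters f = (mu, beta_1, ..., beta_(T-1)) are row vectors of size T:
   [param_coord f 0] is mu and [param_coord f k] is beta_k for 1 <= k < T. *)
Definition param_coord (R : realType) (T : nat) (f : 'rV[R]_T) (k : nat) : R :=
  if insub k is Some i then f 0 i else 0.

Definition true_param (R : realType) (nu : R) (alpha : nat -> R) (T : nat) :
    'rV[R]_T :=
  \row_(i < T) if (i == 0 :> nat)%N then nu else alpha i.

Definition Phi d (Omega : measurableType d) (R : realType)
    (P : probability Omega R) (X : nat -> {RV P >-> nat}) (T : nat)
    (f : 'rV[R]_T) (n : nat) (w : Omega) : R :=
  param_coord f 0 + \sum_(1 <= k < n) param_coord f k * (X (n - k)%N w)%:R.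

Definition gammaT d (Omega : measurableType d) (R : realType)
    (P : probability Omega R) (X : nat -> {RV P >-> nat}) (T : nat)
    (f : 'rV[R]_T) (w : Omega) : R :=
  - (2 / T%:R) * (\sum_(1 <= n < T.+1) Phi X f n w * (X n w)%:R)
  + T%:R^-1 * (\sum_(1 <= n < T.+1) Phi X f n w ^+ 2).

(* f |-> E[gamma f] is a well-defined finite function on the parameter space
   (integrability) and attains its minimum at s. *)
Definition is_contrast d (Omega : measurableType d) (R : realType)
    (P : probability Omega R) (T : nat) (gamma : 'rV[R]_T -> Omega -> R)
    (s : 'rV[R]_T) : Prop :=
  (forall f, P.-integrable [set: Omega] (EFin \o gamma f)) /\
  (forall f, ('E_P[gamma s] <= 'E_P[gamma f])%E).

(* Main.v *)
Require Import Defs.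
From mathcomp Require Import all_boot all_order all_algebra.
From mathcomp Require Import all_classical all_reals all_analysis.
From mathcomp Require Import measurable_realfun.
From mathcomp Require Import ring.
Set Implicit Arguments.
Unset Strict Implicit.
Unset Printing Implicit Defensive.
Import Order.TTheory GRing.Theory Num.Theory.
Import numFieldNormedType.Exports.
Local Open Scope classical_set_scope.
Local Open Scope ring_scope.

(** Conditionally on the past, X_n has mean Phi_s(n) = lambda_n, and Phi_f(n) is
    a function of the past; so X_n - lambda_n is orthogonal to Phi_f(n) for every
    parameter f, and completing the square gives
      E[Phi_f(n)^2 - 2 Phi_f(n) X_n]
        = E[Phi_s(n)^2 - 2 Phi_s(n) X_n] + E[(Phi_f(n) - Phi_s(n))^2].
    The n-th term of the contrast is thus minimal at f = s ([expectation_sq_loss_min]),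
    and averaging over n keeps the inequality.

    For these expectations to make sense, every X_n must be square-integrable.
    The Poisson law gives E[X_n^2] = E[lambda_n + lambda_n^2], and lambda_n is an
    affine combination of X_1, ..., X_(n-1), so this follows by strong induction
    on n ([inar_Lfun2]).

    Since Phi_f(n) is affine in the past counts, its orthogonality to
    X_n - lambda_n reduces to that of the constant 1 and of each X_k with k < n
    ([Phi_innovation_orth]). These are integer-valued, and for an integer-valued
    function G of the past, E[G h(X_n)] splits as a countable sum over the events
    where G = i and X_n = j, each of them computed by the definition of a
    conditional distribution ([integral_mul_cond_distribution]). *)

(** * Moments of the Poisson distribution *)

Section poisson_moments.
Context {R : realType}.
Variables (rate : R) (rate_gt0 : 0 < rate).
Local Open Scope ereal_scope.

Lemma poisson_pmfS j :
  (j.+1%:R * poisson_pmf rate j.+1 = rate * poisson_pmf rate j)%R.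
Proof.
rewrite /poisson_pmf rate_gt0 exprS factS natrM.
have j0 : (j.+1%:R != 0 :> R)%R by rewrite pnatr_eq0.
have f0 : (j`!%:R != 0 :> R)%R by rewrite pnatr_eq0 -lt0n fact_gt0.
by field; rewrite f0 addrC natr1.
Qed.

(** The Stein-Chen identity E[J h(J)] = rate E[h(J+1)] for a Poisson variable J,
    obtained by shifting the series; it yields the first two moments at once,
    with h = 1 and then with h the identity. *)
Lemma nneseries_poisson_shift (h : nat -> R) : (forall j, 0 <= h j)%R ->
  \sum_(j <oo) (j%:R * h j)%:E * (poisson_pmf rate j)%:E =
  rate%:E * \sum_(j <oo) (h j.+1)%:E * (poisson_pmf rate j)%:E.
Proof.
move=> h0.
have p0 j : (0 <= poisson_pmf rate j)%R := poisson_pmf_ge0 rate j.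
rewrite nneseries_recl//; last by move=> k _; rewrite -EFinM lee_fin !mulr_ge0.
rewrite mul0r mul0e add0e -nneseries_addn; last first.
  by move=> k; rewrite -EFinM lee_fin !mulr_ge0.
rewrite -nneseriesZl; last by move=> k _; rewrite -EFinM lee_fin mulr_ge0.
apply: eq_eseriesr => j _; rewrite addn1 -!EFinM; congr EFin.
by rewrite mulrAC poisson_pmfS mulrAC mulrA -!mulrA; congr *%R; rewrite mulrC.
Qed.

Lemma poisson_prob_set1 k j :
  poisson_prob rate k [set j] = (poisson_pmf rate j)%:E.
Proof. by rewrite /poisson_prob rate_gt0 esum_set1// lee_fin poisson_pmf_ge0. Qed.

Lemma nneseries_poisson_pmf : \sum_(j <oo) (poisson_pmf rate j)%:E = 1.
Proof.
rewrite nneseries_esumT; last by move=> n; rewrite lee_fin poisson_pmf_ge0.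
by rewrite -(probability_setT (poisson_prob rate 0%N)) /= /poisson_prob rate_gt0.
Qed.

Lemma nneseries_poisson_mean :
  \sum_(j <oo) (j%:R)%:E * (poisson_pmf rate j)%:E = rate%:E.
Proof.
under eq_eseriesr do rewrite -[(_%:R)%R]mulr1.
rewrite (@nneseries_poisson_shift (fun=> 1%R))//.
under eq_eseriesr do rewrite mul1e.
by rewrite nneseries_poisson_pmf mule1.
Qed.

Lemma nneseries_poisson_sqr :
  \sum_(j <oo) (j%:R ^+ 2)%:E * (poisson_pmf rate j)%:E = (rate + rate ^+ 2)%:E.
Proof.
have p0 j : (0 <= poisson_pmf rate j)%R := poisson_pmf_ge0 rate j.
under eq_eseriesr do rewrite expr2.
rewrite (@nneseries_poisson_shift (fun j => j%:R)%R)//.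
under eq_eseriesr do rewrite -natr1 EFinD ge0_muleDl ?lee_fin// mul1e.
rewrite nneseriesD; last 2 first.
- by move=> i _; rewrite -EFinM lee_fin mulr_ge0.
- by move=> i _; rewrite lee_fin.
rewrite nneseries_poisson_mean nneseries_poisson_pmf -EFinD -EFinM.
by congr EFin; ring.
Qed.

End poisson_moments.

(** * Integration against a conditional distribution on the integers *)

Section conditional_integral.
Context d (Omega : measurableType d) (R : realType) (P : probability Omega R).
Variables (F : set (set Omega)) (Y : {RV P >-> nat}).
Variable kappa : Omega -> set nat -> \bar R.
Hypothesis subF : F `<=` measurable.
Hypothesis kappaE : cond_distribution F Y kappa.
Hypothesis kappa_ge0 : forall w B, (0 <= kappa w B)%E.
Local Open Scope ereal_scope.

Lemma measurable_cond_distribution (B : set nat) :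
  measurable_fun setT (fun w => kappa w B).
Proof.
move=> _ U mU; rewrite setTI; apply: subF.
by have [+ _] := kappaE (B := B) I; exact.
Qed.

Lemma measurable_preimage_nat (Z : {RV P >-> nat}) B : measurable (Z @^-1` B).
Proof. by rewrite -[_ @^-1` _]setTI; exact: (measurable_funP Z). Qed.

Lemma integral_fiber_nat (G : Omega -> nat) (A : set Omega) (f : Omega -> \bar R) :
  (forall i, measurable (A `&` G @^-1` [set i])) ->
  measurable_fun A f -> (forall w, A w -> 0 <= f w) ->
  \int[P]_(w in A) f w = \sum_(i <oo) \int[P]_(w in A `&` G @^-1` [set i]) f w.
Proof.
move=> mG mf f0.
have AE : A = \bigcup_i (A `&` G @^-1` [set i]).
  by rewrite -setI_bigcupr setIidl// => w Aw; exists (G w).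
rewrite [in LHS]AE ge0_integral_bigcup//.
- by rewrite -AE.
- by move=> w; rewrite -AE; exact: f0.
- apply/trivIsetP => i j _ _ /eqP ij; rewrite -subset0 => w [[_ /= Gi] [_ /= Gj]].
  by apply: ij; rewrite -Gi -Gj.
Qed.

(** On the fiber Y = j the integrand is the constant h j, so that the definition
    of a conditional distribution applies fiber by fiber. *)
Lemma integral_cond_distribution (A : set Omega) (h : nat -> R) :
  F A -> (forall j, 0 <= h j)%R ->
  \int[P]_(w in A) (h (Y w))%:E =
  \int[P]_(w in A) \sum_(j <oo) (h j)%:E * kappa w [set j].
Proof.
move=> FA h0; have mA := subF FA.
have mY : measurable_fun A (fun w => (h (Y w))%:E).
  apply: (@measurableT_comp _ _ _ _ _ _ (fun j => (h j)%:E) _ Y) => //.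
  exact: measurable_funTS.
rewrite (@integral_fiber_nat Y)//; last 2 first.
- by move=> i; apply: measurableI => //; exact: measurable_preimage_nat.
- by move=> w _; rewrite lee_fin.
rewrite integral_nneseries//; last 2 first.
- move=> j; apply: measurable_funeM; apply: measurable_funTS.
  exact: measurable_cond_distribution.
- by move=> j w _; rewrite mule_ge0 ?lee_fin.
apply: eq_eseriesr => j _.
rewrite ge0_integralZl//; last 2 first.
- by apply: measurable_funTS; exact: measurable_cond_distribution.
- by rewrite lee_fin.
have [_ /(_ _ FA) <-] := kappaE (B := [set j]) I.
rewrite (eq_integral (fun=> (h j)%:E)).
  rewrite integral_cst//; apply: measurableI => //; exact: measurable_preimage_nat.
by move=> w /set_mem[_ /= ->].
Qed.

(** The tower property E[G h(Y)] = E[G E[h(Y) | F]]: on each fiber of G, which is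
    an event of F, the factor G is constant and can be pulled out. *)
Lemma integral_mul_cond_distribution (G : Omega -> nat) (h : nat -> R) :
  (forall B, F (G @^-1` B)) -> (forall j, 0 <= h j)%R ->
  \int[P]_w ((G w)%:R * h (Y w))%:E =
  \int[P]_w ((G w)%:R%:E * \sum_(j <oo) (h j)%:E * kappa w [set j]).
Proof.
move=> FG h0.
have mG : measurable_fun setT (fun w => (G w)%:R%R : R).
  apply: (@measurableT_comp _ _ _ _ _ _ (fun j : nat => j%:R%R : R) _ G) => //.
  by move=> _ B _; rewrite setTI; apply: subF.
have mh : measurable_fun setT (fun w => h (Y w)).
  exact: (@measurableT_comp _ _ _ _ _ _ h _ Y).
have mK : measurable_fun setT (fun w => \sum_(j <oo) (h j)%:E * kappa w [set j]).
  apply: ge0_emeasurable_sum => [j w _ _|j _]; first by rewrite mule_ge0 ?lee_fin.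
  by apply: measurable_funeM; exact: measurable_cond_distribution.
have K0 w : 0 <= \sum_(j <oo) (h j)%:E * kappa w [set j].
  by apply: nneseries_ge0 => j _ _; rewrite mule_ge0 ?lee_fin.
have mGA i : measurable (setT `&` G @^-1` [set i]) by rewrite setTI; exact: subF.
rewrite (integral_fiber_nat mGA); last 2 first.
- by apply/measurable_EFinP; exact: measurable_funM.
- by move=> w _; rewrite lee_fin mulr_ge0.
rewrite (integral_fiber_nat mGA); last 2 first.
- by apply: emeasurable_funM => //; exact/measurable_EFinP.
- by move=> w _; rewrite mule_ge0 ?lee_fin.
apply: eq_eseriesr => i _; rewrite setTI.
transitivity (\int[P]_(w in G @^-1` [set i]) (i%:R%:E * (h (Y w))%:E)).
  by apply: eq_integral => w /set_mem /= ->; rewrite EFinM.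
transitivity (\int[P]_(w in G @^-1` [set i])
    (i%:R%:E * \sum_(j <oo) (h j)%:E * kappa w [set j])); last first.
  by apply: eq_integral => w /set_mem /= ->.
have mA := subF (FG [set i]).
rewrite !ge0_integralZl ?lee_fin//.
- by rewrite (integral_cond_distribution (FG _) h0).
- exact: measurable_funTS.
- by apply: measurable_funTS; exact/measurable_EFinP.
- by move=> w _; rewrite lee_fin.
Qed.

End conditional_integral.

(** * Integrable and square-integrable functions *)

Section square_integrable.
Context d (Omega : measurableType d) (R : realType) (P : probability Omega R).

Lemma integrable_sqr_Lfun2 (f : Omega -> R) : measurable_fun setT f ->
  (\int[P]_w (f w ^+ 2)%:E < +oo)%E -> f \in Lfun P 2%:E.
Proof.
move=> mf foo; rewrite inE; apply/andP; split; rewrite inE//=.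
rewrite /finite_norm unlock poweR_lty//.
rewrite (eq_integral (fun w => (f w ^+ 2)%:E))// => w _ /=.
by rewrite powR_mulrn// real_normK ?num_real.
Qed.

Lemma Lfun2_lin (f g : Omega -> R) (a : R) : f \in Lfun P 2%:E ->
  g \in Lfun P 2%:E -> (fun w => f w + a * g w) \in Lfun P 2%:E.
Proof.
move=> f2 g2.
have ->: (fun w => f w + a * g w) = f \+ (a \o* g).
  by apply/funext => w /=; rewrite mulrC.
have [_ +] := Lfun_addr_closed P (lee1n 2).
by apply => //; apply: Lfun_scale => //; rewrite ler1n.
Qed.

Lemma Lfun1_lin (f g : Omega -> R) (a : R) : f \in Lfun P 1 ->
  g \in Lfun P 1 -> (fun w => f w + a * g w) \in Lfun P 1.
Proof.
move=> f2 g2.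
have ->: (fun w => f w + a * g w) = f \+ (a \o* g).
  by apply/funext => w /=; rewrite mulrC.
have [_ +] := Lfun_addr_closed P (lexx 1%E).
by apply => //; apply: Lfun_scale.
Qed.

Lemma Lfun2_mul (f g : Omega -> R) : f \in Lfun P 2%:E ->
  g \in Lfun P 2%:E -> (fun w => f w * g w) \in Lfun P 1.
Proof. exact: Lfun2_mul_Lfun1. Qed.

Lemma expectation_lin (f g : Omega -> R) (a : R) : f \in Lfun P 1 ->
  g \in Lfun P 1 -> 'E_P[(fun w => f w + a * g w)%R]%E = ('E_P[f] + a%:E * 'E_P[g])%E.
Proof.
move=> f1 g1.
have ->: (fun w => f w + a * g w) = f \+ (a \o* g).
  by apply/funext => w /=; rewrite mulrC.
by rewrite expectationD ?expectationZl//; apply: Lfun_scale.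
Qed.

Lemma Lfun1_sum_nat (F : nat -> Omega -> R) m n :
  (forall i, (m <= i < n)%N -> F i \in Lfun P 1) ->
  (fun w => \sum_(m <= i < n) F i w) \in Lfun P 1.
Proof.
move=> FL.
have -> : (fun w => \sum_(m <= i < n) F i w) = \sum_(m <= i < n) F i.
  by apply/funext => w; rewrite fct_sumE.
rewrite big_nat; apply: rpred_sum => i; exact: FL.
Qed.

Lemma expectation_sum_nat (F : nat -> Omega -> R) m n :
  (forall i, (m <= i < n)%N -> F i \in Lfun P 1) ->
  ('E_P[(fun w => \sum_(m <= i < n) F i w)%R] =
   \sum_(m <= i < n) 'E_P[F i])%E.
Proof.
move=> FL.
have -> : (fun w => \sum_(m <= i < n) F i w) =
    \sum_(g <- [seq F i | i <- index_iota m n]) g.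
  by apply/funext => w; rewrite big_map fct_sumE.
rewrite expectation_sum ?big_map// => g /mapP[i + ->].
by rewrite mem_index_iota; exact: FL.
Qed.

(** Intensities and the functions Phi_f(n) are affine combinations of counts; what
    has to be known about them is stable under linear combinations, hence is
    inherited from the constants and the counts. *)
Lemma affine_comb_ind (S : (Omega -> R) -> Prop) (c : R) (a : nat -> R)
    (h : nat -> Omega -> R) (m : nat) :
  S (fun=> c) ->
  (forall f g b, S f -> S g -> S (fun w => f w + b * g w)) ->
  (forall k, (1 <= k < m)%N -> S (h k)) ->
  S (fun w => c + \sum_(1 <= k < m) a k * h k w).
Proof.
move=> Sc Slin; elim: m => [|m ih] Sh.
  by under eq_fun do rewrite big_geq// addr0.
have [->|m0] := posnP m; first by under eq_fun do rewrite big_geq// addr0.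
under eq_fun do rewrite big_nat_recr//= addrA.
apply: Slin; last by apply: Sh; rewrite m0 /=.
by apply: ih => k /andP[k1 km]; apply: Sh; rewrite k1 ltnW.
Qed.

End square_integrable.

(** * Moments and innovations of an INAR process *)

Section inar.
Context d (Omega : measurableType d) (R : realType) (P : probability Omega R).
Variables (nu : R) (alpha : nat -> R) (X : nat -> {RV P >-> nat}).
Hypothesis nu_gt0 : 0 < nu.
Hypothesis alpha_ge0 : forall k : nat, (1 <= k)%N -> 0 <= alpha k.
Hypothesis inarX : is_INAR nu alpha X.

Local Notation lam := (inar_intensity nu alpha X).
Local Notation x n := (fun w => (X n w)%:R%R : R).

Lemma inar_intensity_gt0 n w : 0 < lam n w.
Proof.
rewrite /inar_intensity ltr_wpDr// big_nat sumr_ge0// => k /andP[_ kn].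
by rewrite mulr_ge0// alpha_ge0// subn_gt0.
Qed.

Lemma nat_filtration_measurable n : nat_filtration X n `<=` measurable.
Proof.
apply: smallest_sub; first exact: sigma_algebra_measurable.
apply: (big_ind (fun C : set (set Omega) => C `<=` measurable)) => //.
  by move=> A B mA mB; rewrite subUset.
by move=> i _ _ [B _ <-]; rewrite setTI; exact: measurable_preimage_nat.
Qed.

Lemma nat_filtration_preimage n k B : (1 <= k <= n)%N ->
  nat_filtration X n (X k @^-1` B).
Proof.
case: k => // k kn.
apply: sub_sigma_algebra; rewrite (bigD1 (Ordinal kn))//=.
by left; exists B => //; rewrite setTI.
Qed.

Lemma nat_filtration_cst n (i : nat) (B : set nat) :
  nat_filtration X n ((fun=> i) @^-1` B).
Proof.
have sF : sigma_algebra setT (nat_filtration X n) by exact: smallest_sigma_algebra.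
rewrite preimage_cst; case: ifPn => _; last by case: sF.
by rewrite -[setT]setD0; case: sF => F0 FC _; exact: FC.
Qed.

Lemma measurable_natr n : measurable_fun setT (x n).
Proof.
exact: (@measurableT_comp _ _ _ _ _ _ (fun j : nat => j%:R%R : R) _ (X n)).
Qed.

Lemma integral_inar_mul n (G : Omega -> nat) : (1 <= n)%N ->
  (forall B, nat_filtration X n.-1 (G @^-1` B)) ->
  (\int[P]_w ((G w)%:R * (X n w)%:R)%:E = \int[P]_w ((G w)%:R * lam n w)%:E)%E.
Proof.
move=> n1 FG.
rewrite (integral_mul_cond_distribution (@nat_filtration_measurable _)
  (inarX n1) _ FG (h := fun j => j%:R))//.
apply: eq_integral => w _; rewrite EFinM; congr (_ * _)%E.
under eq_eseriesr do rewrite poisson_prob_set1 ?inar_intensity_gt0//.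
by rewrite nneseries_poisson_mean// inar_intensity_gt0.
Qed.

Lemma integral_inar_sqr n : (1 <= n)%N ->
  (\int[P]_w ((X n w)%:R ^+ 2)%:E = \int[P]_w (lam n w + lam n w ^+ 2)%:E)%E.
Proof.
move=> n1.
(* The tower property is used with the constant count G = 1. *)
transitivity (\int[P]_w (1%:R * (X n w)%:R ^+ 2 : R)%:E)%E.
  by apply: eq_integral => w _; rewrite mul1r.
rewrite (integral_mul_cond_distribution (@nat_filtration_measurable _)
  (inarX n1) _ (@nat_filtration_cst _ 1%N) (h := fun j => j%:R ^+ 2))//.
apply: eq_integral => w _; rewrite mul1e.
under eq_eseriesr do rewrite poisson_prob_set1 ?inar_intensity_gt0//.
by rewrite nneseries_poisson_sqr// inar_intensity_gt0.
Qed.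

Lemma affine_intensity_Lfun2 n : (forall k, (1 <= k < n)%N -> x k \in Lfun P 2%:E) ->
  lam n \in Lfun P 2%:E.
Proof.
move=> xL.
apply: (@affine_comb_ind _ _ _ (fun f => f \in Lfun P 2%:E) nu
  (fun k => alpha (n - k)%N) (fun k => x k) n) => //; first exact: Lfun_cst.
exact: Lfun2_lin.
Qed.

(** E[X_n^2] = E[lambda_n + lambda_n^2], where lambda_n is square-integrable as an
    affine combination of earlier counts. *)
Lemma inar_Lfun2 n : (1 <= n)%N -> x n \in Lfun P 2%:E.
Proof.
elim/ltn_ind: n => n ih n1.
have lL : lam n \in Lfun P 2%:E.
  by apply: affine_intensity_Lfun2 => k /andP[k1 kn]; exact: ih.
apply: integrable_sqr_Lfun2; first exact: measurable_natr.
rewrite integral_inar_sqr//.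
apply: integrable_lty => //; apply/Lfun1_integrable.
have l1 : lam n \in Lfun P 1.
  by apply: Lfun_subset12 lL; exact: fin_num_measure.
have := Lfun1_lin 1 l1 (Lfun2_mul lL lL).
by under eq_fun do rewrite mul1r.
Qed.

Lemma inar_intensity_Lfun2 n : lam n \in Lfun P 2%:E.
Proof. by apply: affine_intensity_Lfun2 => k /andP[k1 _]; exact: inar_Lfun2. Qed.

(** Written as a sum with coefficient -1 to match the shape of [expectation_lin]. *)
Definition inar_innovation n w : R := (X n w)%:R + (-1) * lam n w.

Lemma inar_innovation_Lfun2 n : (1 <= n)%N -> inar_innovation n \in Lfun P 2%:E.
Proof.
move=> n1; apply: Lfun2_lin; last exact: inar_intensity_Lfun2.
exact: inar_Lfun2.
Qed.

(** Square integrability of G makes the two equal nonnegative integrals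
    E[G X_n] and E[G lambda_n] finite, so that they may be subtracted. *)
Lemma innovation_orth_nat n (G : Omega -> nat) : (1 <= n)%N ->
  (forall B, nat_filtration X n.-1 (G @^-1` B)) ->
  (fun w => (G w)%:R) \in Lfun P 2%:E ->
  ('E_P[(fun w => (G w)%:R * inar_innovation n w)%R] = 0)%E.
Proof.
move=> n1 FG GL.
have [xL lL] := (inar_Lfun2 n1, inar_intensity_Lfun2 n).
rewrite (_ : (fun w => _) =
    fun w => (G w)%:R * (X n w)%:R + (-1) * ((G w)%:R * lam n w)); last first.
  by apply/funext => w; rewrite /inar_innovation; ring.
rewrite expectation_lin//; [|exact: (Lfun2_mul GL)..].
have fG : 'E_P[(fun w => (G w)%:R * lam n w)%R]%E \is a fin_num.
  by apply: expectation_fin_num; exact: Lfun2_mul.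
rewrite [X in (X + _)%E](_ : _ = 'E_P[(fun w => (G w)%:R * lam n w)%R]%E).
  by rewrite mulN1e subee.
by rewrite unlock; exact: integral_inar_mul.
Qed.

(** Orthogonality to the innovation is a linear condition on functions of the past,
    so it passes from the constants and the counts X_k, k < n, to Phi_f(n). *)
Lemma Phi_innovation_orth n T (f : 'rV[R]_T) : (1 <= n)%N ->
  Phi X f n \in Lfun P 2%:E /\
  ('E_P[(fun w => Phi X f n w * inar_innovation n w)%R] = 0)%E.
Proof.
move=> n1.
apply: (@affine_comb_ind _ _ _ (fun g => g \in Lfun P 2%:E /\
   ('E_P[(fun w => g w * inar_innovation n w)%R] = 0)%E) _
  (param_coord f) (fun k => x (n - k)) n) => //.
- split; first exact: Lfun_cst.
  have := innovation_orth_nat n1 (@nat_filtration_cst _ 1%N) (Lfun_cst P 1%:R 2).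
  have D1 : (fun w => 1 * inar_innovation n w) \in Lfun P 1.
    by apply: Lfun2_mul => //; [exact: Lfun_cst|exact: inar_innovation_Lfun2].
  move=> E0.
  rewrite (_ : (fun w => _) = param_coord f 0 \o* (fun w => 1 * inar_innovation n w)).
    by rewrite expectationZl// E0 mule0.
  by apply/funext => w /=; rewrite mul1r mulrC.
- move=> g h b [gL g0] [hL h0]; split; first exact: Lfun2_lin.
  rewrite (_ : (fun w => _) =
    fun w => g w * inar_innovation n w + b * (h w * inar_innovation n w));
    last by apply/funext => w; ring.
  have Dn := inar_innovation_Lfun2 n1.
  by rewrite expectation_lin; [rewrite g0 h0 mule0 adde0|exact: Lfun2_mul..].
- move=> k /andP[k1 kn].
  have nk : (1 <= n - k)%N by rewrite subn_gt0.
  split; first exact: inar_Lfun2.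
  apply: innovation_orth_nat => //; last exact: inar_Lfun2.
  move=> B; apply: nat_filtration_preimage; rewrite nk /=.
  by case: n k1 kn {n1 nk} => // n k1 kn; rewrite leq_subLR -add1n leq_add2r.
Qed.

Lemma Phi_true_param T n : (1 <= n <= T)%N ->
  Phi X (true_param nu alpha T) n = lam n.
Proof.
move=> /andP[n1 nT].
have coord k : (k < n)%N ->
    param_coord (true_param nu alpha T) k = if k == 0%N then nu else alpha k.
  move=> kn; rewrite /param_coord insubT ?(leq_trans kn)// => kT.
  by rewrite mxE.
apply/funext => w; rewrite /Phi /inar_intensity coord//; congr (_ + _).
(* Phi sums over lags k, the intensity over past times n - k. *)
rewrite [RHS]big_nat_rev/= !big_nat; apply: eq_bigr => k /andP[k1 kn].
rewrite coord// gtn_eqF// add1n subSS; congr (_ * _).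
by rewrite subKn// ltnW.
Qed.

(** * The least-squares contrast *)

Definition sq_loss T (f : 'rV[R]_T) n w : R :=
  Phi X f n w ^+ 2 + (- 2) * (Phi X f n w * (X n w)%:R).

Lemma sq_loss_Lfun1 T (f : 'rV[R]_T) n : (1 <= n)%N -> sq_loss f n \in Lfun P 1.
Proof.
move=> n1; have [fL _] := Phi_innovation_orth f n1.
by apply: Lfun1_lin; [exact: Lfun2_mul|exact: (Lfun2_mul fL (inar_Lfun2 n1))].
Qed.

(** With h = Phi_f(n) - Phi_s(n), the loss at f is the loss at s plus h^2 minus
    2 h (X_n - lambda_n), and the last term has zero mean. *)
Lemma expectation_sq_loss_min T (f : 'rV[R]_T) n : (1 <= n <= T)%N ->
  ('E_P[sq_loss (true_param nu alpha T) n] <= 'E_P[sq_loss f n])%E.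
Proof.
move=> nT; have [n1 _] := andP nT.
pose s := true_param nu alpha T.
have [fL f0] := Phi_innovation_orth f n1.
have [sL s0] := Phi_innovation_orth s n1.
have sE := Phi_true_param nT; rewrite -/s in sE.
pose h w := Phi X f n w + (-1) * Phi X s n w.
have hL : h \in Lfun P 2%:E by exact: Lfun2_lin.
have h0 : ('E_P[(fun w => h w * inar_innovation n w)%R] = 0)%E.
  rewrite (_ : (fun w => _) = fun w => Phi X f n w * inar_innovation n w +
      (-1) * (Phi X s n w * inar_innovation n w)); last first.
    by apply/funext => w; rewrite /h; ring.
  have Dn := inar_innovation_Lfun2 n1.
  by rewrite expectation_lin; [rewrite f0 s0 mule0 adde0|exact: Lfun2_mul..].
have -> : sq_loss f n = fun w => (sq_loss s n w + 1 * (h w * h w)) +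
    (- 2) * (h w * inar_innovation n w).
  by apply/funext => w; rewrite /sq_loss /h /inar_innovation sE; ring.
have hh : (fun w => h w * h w) \in Lfun P 1 by exact: Lfun2_mul.
have hD : (fun w => h w * inar_innovation n w) \in Lfun P 1.
  by apply: Lfun2_mul => //; exact: inar_innovation_Lfun2.
have sl : sq_loss s n \in Lfun P 1 by exact: sq_loss_Lfun1.
rewrite [leRHS]expectation_lin ?h0 ?mule0 ?adde0//; last exact: Lfun1_lin.
rewrite [leRHS]expectation_lin//.
rewrite mul1e leeDl// expectation_ge0// => w.
by rewrite -expr2 sqr_ge0.
Qed.

Lemma gammaT_sq_loss T (f : 'rV[R]_T) :
  gammaT X f = fun w => \sum_(1 <= n < T.+1) T%:R^-1 * sq_loss f n w.
Proof.
apply/funext => w; rewrite /gammaT -mulr_sumr big_split/= -mulr_sumr; ring.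
Qed.

Lemma gammaT_is_contrast T :
  is_contrast P (@gammaT d Omega R P X T) (true_param nu alpha T).
Proof.
have Tloss f n : (1 <= n < T.+1)%N ->
    (fun w => T%:R^-1 * @sq_loss T f n w) \in Lfun P 1.
  move=> /andP[n1 _]; have := Lfun_scale T%:R^-1 (lexx 1) (sq_loss_Lfun1 f n1).
  by under eq_fun do rewrite mulrC.
have Egamma f : ('E_P[gammaT X f] =
    \sum_(1 <= n < T.+1) T%:R^-1%:E * 'E_P[@sq_loss T f n])%E.
  rewrite gammaT_sq_loss expectation_sum_nat; last exact: Tloss.
  apply: eq_big_nat => n /andP[n1 _].
  rewrite -expectationZl ?sq_loss_Lfun1//; congr expectation.
  by apply/funext => w /=; rewrite mulrC.
split=> f.
  apply/Lfun1_integrable; rewrite gammaT_sq_loss.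
  by apply: Lfun1_sum_nat; exact: Tloss.
rewrite !Egamma [leLHS]big_nat [leRHS]big_nat; apply: lee_sum => n nT.
by apply: lee_wpmul2l; [rewrite lee_fin invr_ge0|exact: expectation_sq_loss_min].
Qed.

End inar.

Theorem theorem1 (d : measure_display) (Omega : measurableType d)
    (R : realType) (P : probability Omega R)
    (nu : R) (alpha : nat -> R)
    (N : nat -> Omega -> nat) (X : nat -> {RV P >-> nat}) (T : nat)
    (nu_gt0 : 0 < nu)
    (alpha_ge0 : forall k : nat, (1 <= k)%N -> 0 <= alpha k)
    (alpha_l1 : (l1norm alpha < 1)%E)
    (alpha_l2 : (l2norm_sq alpha < (2^-1)%:E)%E)
    (inarN : is_cumulative_INAR nu alpha N X)
    (T_gt0 : (0 < T)%N) :
  is_contrast P (@gammaT d Omega R P X T) (true_param nu alpha T).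
Proof.
by case: inarN => inarX _; exact: gammaT_is_contrast.
Qed.
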